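(* Let $G$ be a connected graph of order $n$, let $\tau\geq 2$ be an integer, let $\alpha\in[\frac{1}{2},\frac{3}{4})$, and suppose $$n\geq\max\Big\{4\tau^2+5\tau+1,\ \frac{8\tau(1-\alpha)-2\alpha+1}{3-4\alpha}\Big\}.$$ If $\rho_{\alpha}(G)\geq\rho_{\alpha}\big(K_{\tau-1}\vee(K_{n-\tau}\cup K_{1})\big)$, then $G$ is $\tau$-tough, unless $G\cong K_{\tau-1}\vee(K_{n-\tau}\cup K_{1})$.
   Context: For a graph $G$, $A(G)$ is its adjacency matrix and $D(G)$ the diagonal matrix of vertex degrees. For $\alpha\in[0,1]$, $A_{\alpha}(G)=\alpha D(G)+(1-\alpha)A(G)$, and $\rho_{\alpha}(G)$ denotes the largest eigenvalue of $A_{\alpha}(G)$. $c(H)$ denotes the number of connected components of $H$. For a real $\tau>0$, a graph $G$ is $\tau$-tough if $|S|\geq\tau\,(c(G-S)-1)$ for every proper subset $S\subsetneq V(G)$ with $c(G-S)>1$ (a complete graph has no such $S$). $K_m$ is the complete graph on $m$ vertices, $\cup$ is disjoint union, and $G_1\vee G_2$ (join) is obtained from $G_1\cup G_2$ by adding all edges between $V(G_1)$ and $V(G_2)$. *)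

(* Defs.v *)
From mathcomp Require Import all_boot all_order all_algebra.
Set Implicit Arguments. Unset Strict Implicit. Unset Printing Implicit Defensive.
Import Order.TTheory GRing.Theory Num.Theory.

Definition simple_graph (n : nat) (e : rel 'I_n) : Prop :=
  symmetric e /\ irreflexive e.

Definition connected_graph (n : nat) (e : rel 'I_n) : Prop :=
  forall x y : 'I_n, connect e x y.

Definition deg (n : nat) (e : rel 'I_n) (i : 'I_n) : nat := #|[set j | e i j]|.

Local Open Scope ring_scope.

Definition adjmx (R : nzRingType) (n : nat) (e : rel 'I_n) : 'M[R]_n :=
  \matrix_(i, j) (if e i j then 1 else 0).
Definition degmx (R : nzRingType) (n : nat) (e : rel 'I_n) : 'M[R]_n :=
  \matrix_(i, j) (if i == j then (deg e i)%:R else 0).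
Definition A_alpha (R : nzRingType) (alpha : R) (n : nat) (e : rel 'I_n) : 'M[R]_n :=
  alpha *: degmx R e + (1 - alpha) *: adjmx R e.

Definition is_largest_eigenvalue (R : realFieldType) (n : nat) (M : 'M[R]_n) (r : R) : Prop :=
  eigenvalue M r /\ forall x : R, eigenvalue M x -> x <= r.

Local Close Scope ring_scope.

Definition del_rel (n : nat) (e : rel 'I_n) (S : {set 'I_n}) : rel 'I_n :=
  [rel x y | [&& e x y, x \notin S & y \notin S]].

Definition ncomp_del (n : nat) (e : rel 'I_n) (S : {set 'I_n}) : nat :=
  #|[set [set y in ~: S | connect (del_rel e S) x y] | x in ~: S]|.

Definition tough (n : nat) (e : rel 'I_n) (tau : nat) : Prop :=
  forall S : {set 'I_n}, S != [set: 'I_n] -> 1 < ncomp_del e S ->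
    tau * (ncomp_del e S - 1) <= #|S|.

(* K_{tau-1} \vee (K_{n-tau} \cup K_1) on 'I_n: vertices 0..tau-2 form the
   K_{tau-1}, vertex n-1 is the K_1, vertices tau-1..n-2 form the K_{n-tau}. *)
Definition extremal_graph (n tau : nat) : rel 'I_n :=
  fun x y : 'I_n => (x != y) &&
     [|| (val x < tau.-1), (val y < tau.-1) | ((val x != n.-1) && (val y != n.-1))].

Definition graph_iso (n : nat) (e1 e2 : rel 'I_n) : Prop :=
  exists f : 'I_n -> 'I_n, bijective f /\ forall x y, e1 x y = e2 (f x) (f y).
Arguments extremal_graph : clear implicits.

(* Main.v *)
(* If e is not tough, the removal of some S with |S| < tau k leaves k + 1 >= 2
   components. Either some vertex has degree less than tau, or e misses at least
   2n - 4 tau - 1 edges.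

   In the second case the Collatz-Wielandt bound for the degree vector gives
   rho(e) <= n - 2, while the extremal graph has a positive eigenvector with
   eigenvalue mu > n - 2.

   In the first case e embeds in the extremal graph, and the pulled back positive
   eigenvector is a supersolution for e with constant mu, so rho(e) <= mu; equality
   forces every row inequality to be an equality, hence the embedding is an
   isomorphism. *)
Require Import Defs.
From mathcomp Require Import all_boot all_order all_algebra.
From mathcomp Require Import zify ring lra.
Import Order.TTheory GRing.Theory Num.Theory.
Set Implicit Arguments. Unset Strict Implicit. Unset Printing Implicit Defensive.

(** * Collatz-Wielandt comparison for [A_alpha] *)

Section CollatzWielandt.
Local Open Scope ring_scope.
Variables (R : realFieldType) (alpha : R) (n : nat).
Implicit Types (e : rel 'I_n) (z : 'I_n -> R).

(** The action of [A_alpha] on [z], as one sum over the edges at [x]: graphs and vectors can then be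
    compared edge by edge. *)
Definition A_alpha_act e z (x : 'I_n) : R :=
  \sum_(j | e x j) (alpha * z x + (1 - alpha) * z j).

Lemma A_alpha_actE e z x : A_alpha_act e z x =
  alpha * (deg e x)%:R * z x + (1 - alpha) * \sum_(j | e x j) z j.
Proof.
rewrite /A_alpha_act big_split /= sumr_const -mulr_sumr /deg cardsE.
by rewrite mulrAC mulr_natr.
Qed.

Lemma eigenvalue_A_alpha e (r : R) : symmetric e ->
  reflect (exists2 z, (exists x, z x != 0) & forall x, A_alpha_act e z x = r * z x)
          (eigenvalue (A_alpha alpha e) r).
Proof.
move=> sym_e.
have actE (v : 'rV[R]_n) x : (v *m A_alpha alpha e) 0 x = A_alpha_act e (v 0) x.
  rewrite A_alpha_actE !mxE.
  under eq_bigr => j _ do rewrite !mxE mulrDr.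
  rewrite big_split /=; congr (_ + _).
    rewrite (bigD1 x) //= big1 ?addr0 => [|j /negPf->]; last by rewrite !mulr0.
    by rewrite eqxx mulrC.
  rewrite [in RHS]big_mkcond mulr_sumr; apply: eq_bigr => j _.
  by rewrite sym_e; case: (e x j); ring.
apply: (iffP eigenvalueP) => [[v vA v0]|[z [x zx0] zA]].
  exists (v 0) => [|x]; last by rewrite -actE vA mxE.
  by case/rV0Pn: v0 => x; exists x.
exists (\row_j z j).
  apply/rowP => y; rewrite actE !mxE -zA.
  by apply: eq_bigr => j _; rewrite !mxE.
by apply/rV0Pn; exists x; rewrite mxE.
Qed.

(** For an eigenvector [v] of [r], take the least [c] with [|v| <= c * z]. At a vertex where the two
    sides touch, [r * c * z <= A |v| <= c * A z <= mu * c * z]. If [mu <= r], these are equalities,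
    so every neighbour is a touching vertex too, and connectedness spreads this to the whole
    graph. *)
Lemma Collatz_Wielandt e z (mu r : R) :
    symmetric e -> 0 < alpha < 1 ->
    (forall x, 0 < z x) -> (forall x, A_alpha_act e z x <= mu * z x) ->
    eigenvalue (A_alpha alpha e) r ->
  r <= mu /\
  (connected_graph e -> mu <= r -> forall x, A_alpha_act e z x = mu * z x).
Proof.
move=> sym_e /andP[a0 a1] z_gt0 z_sup /(eigenvalue_A_alpha _ sym_e)[v [x0 vx0] vA].
have b0 : 0 < 1 - alpha by rewrite subr_gt0.
pose q x := `|v x| / z x.
have [i _ q_max] := @arg_maxP _ _ _ x0 xpredT q isT.
set c := q i in q_max.
have c_gt0 : 0 < c.
  by apply: lt_le_trans (q_max x0 isT); rewrite divr_gt0 ?normr_gt0.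
have v_le x : `|v x| <= c * z x by rewrite -ler_pdivrMr //; exact: q_max.
have v_sub x : r * `|v x| <= A_alpha_act e (fun y => `|v y|) x.
  apply: (@le_trans _ _ `|r * v x|); first by rewrite normrM ler_wpM2r ?ler_norm.
  rewrite -vA; apply: le_trans (ler_norm_sum _ _ _) _; apply: ler_sum => j _.
  by apply: le_trans (ler_normD _ _) _; rewrite !normrM (gtr0_norm a0) (gtr0_norm b0).
have v_i : `|v i| = c * z i by rewrite /c /q divfK ?gt_eqF.
(* At a touching vertex every edge contributes a nonnegative term to [c * A z - A |v|]; if the sum
   vanishes, each term does, so the neighbours touch. *)
have tight x : `|v x| = c * z x -> forall j, e x j ->
    0 <= alpha * (c * z x - `|v x|) + (1 - alpha) * (c * z j - `|v j|).
  by move=> vx j _; rewrite vx subrr mulr0 add0r mulr_ge0 ?subr_ge0 // ltW.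
have gap x : \sum_(j | e x j)
     (alpha * (c * z x - `|v x|) + (1 - alpha) * (c * z j - `|v j|)) =
   c * A_alpha_act e z x - A_alpha_act e (fun y => `|v y|) x.
  rewrite /A_alpha_act mulr_sumr -sumrB; apply: eq_bigr => j _; ring.
split=> [|conn_e mu_r].
  have gap_ge0 : 0 <= c * A_alpha_act e z i - A_alpha_act e (fun y => `|v y|) i.
    by rewrite -gap sumr_ge0 // => j; apply: tight.
  have cz : 0 < c * z i by rewrite mulr_gt0.
  have cAz : c * A_alpha_act e z i <= c * (mu * z i) by rewrite ler_pM2l.
  have := v_sub i; rewrite v_i => vi; rewrite -(ler_pM2r cz); lra.
have step x : `|v x| = c * z x -> A_alpha_act e z x = mu * z x /\
    forall j, e x j -> `|v j| = c * z j.
  move=> vx.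
  have cz : 0 < c * z x by rewrite mulr_gt0.
  have gap_ge0 : 0 <= c * A_alpha_act e z x - A_alpha_act e (fun y => `|v y|) x.
    by rewrite -gap sumr_ge0 // => j; apply: tight.
  have cAz : c * A_alpha_act e z x <= c * (mu * z x) by rewrite ler_pM2l.
  have := v_sub x; rewrite vx => vsx.
  have mrz : mu * (c * z x) <= r * (c * z x) by rewrite ler_pM2r.
  split; first by apply: (mulfI (lt0r_neq0 c_gt0)); lra.
  have /eqP : \sum_(j | e x j)
     (alpha * (c * z x - `|v x|) + (1 - alpha) * (c * z j - `|v j|)) = 0.
    by rewrite gap; lra.
  rewrite psumr_eq0; last by apply: tight.
  move=> /allP sum0 j exj; have := sum0 j; rewrite mem_index_enum exj vx subrr.
  rewrite mulr0 add0r mulf_eq0 gt_eqF //= subr_eq0 => /(_ isT)/eqP; lra.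
have closed p y : `|v y| = c * z y -> path e y p -> `|v (last y p)| = c * z (last y p).
  by elim: p y => //= w p IHp y vy /andP[/(proj2 (step y vy))]; exact: IHp.
move=> x; apply: (proj1 (step x _)).
by have /connectP[p ep ->] := conn_e i x; apply: closed.
Qed.
End CollatzWielandt.

(** * Elementary degree counts *)

Section Degrees.
Variables (n : nat) (e : rel 'I_n).

Lemma sum1_non_nbrs (x : 'I_n) : \sum_(j | ~~ e x j) 1 = n - deg e x.
Proof.
have -> : deg e x = #|e x| by rewrite /deg cardsE.
by rewrite sum1_card -[n in n - _]card_ord -(cardC (e x)) addKn.
Qed.

Lemma deg_lt (x : 'I_n) : irreflexive e -> deg e x < n.
Proof.
move=> irr_e; rewrite -subn_gt0 -sum1_non_nbrs sum1_card; apply/card_gt0P; exists x.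
by rewrite unfold_in /= irr_e.
Qed.

Lemma deg_gt0 (x : 'I_n) : connected_graph e -> 1 < n -> 0 < deg e x.
Proof.
move=> conn_e n_gt1.
have /card_gt0P[y] : 0 < #|[set~ x]| by rewrite cardsC1 card_ord; lia.
rewrite !inE => yx; have /connectP[[|z p] /=] := conn_e x y.
  by move=> _ xy; rewrite xy eqxx in yx.
by case/andP=> exz _ _; apply/card_gt0P; exists z; rewrite inE.
Qed.

Lemma sum_deg_nbrs_le (x : 'I_n) : irreflexive e ->
  \sum_(j | e x j) deg e j <= deg e x * n.-1.
Proof.
move=> irr_e; rewrite {2}/deg cardsE -sum_nat_const; apply: leq_sum => j _.
by have := deg_lt j irr_e; lia.
Qed.

(** Among the non-neighbours of [x], the vertex [x] itself contributes [deg e x], and each of the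
    other [n - 1 - deg e x] at least 1. *)
Lemma sum_deg_nbrs_add_le (x : 'I_n) :
  irreflexive e -> (forall y, 0 < deg e y) ->
  \sum_(j | e x j) deg e j + n.-1 <= \sum_j deg e j.
Proof.
move=> irr_e deg_e; rewrite [leqRHS](bigID (e x)) /= leq_add2l.
rewrite (bigD1 x) /=; last by rewrite irr_e.
have : \sum_(i | ~~ e x i && (i != x)) 1 <= \sum_(i | ~~ e x i && (i != x)) deg e i.
  by apply: leq_sum => j _; exact: deg_e.
have := sum1_non_nbrs x; rewrite (bigD1 x) /=; last by rewrite irr_e.
have := deg_e x; have := deg_lt x irr_e; lia.
Qed.

End Degrees.

(** * Eigenvalue bound from the number of missing edges *)

Section DegreeBound.
Local Open Scope ring_scope.

(** The test vector is the degree vector; [n * (n - 1)] minus the degree sum is twice the number of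
    missing edges. *)
Lemma eigenvalue_le_sum_deg (R : realFieldType) (alpha r : R) (n : nat) (e : rel 'I_n) :
  simple_graph e -> (forall x, (0 < deg e x)%N) -> (1 < n)%N ->
  1 / 2 <= alpha < 1 ->
  n%:R - 1 <= (1 - alpha) * (n%:R * (n%:R - 1) - (\sum_x deg e x)%:R) ->
  eigenvalue (A_alpha alpha e) r -> r <= n%:R - 2.
Proof.
move=> [sym_e irr_e] deg_e n_gt1 /andP[a12 a1] few eig_r.
have deg_sup x : A_alpha_act alpha e (fun y => (deg e y)%:R) x <= (n%:R - 2) * (deg e x)%:R.
  rewrite A_alpha_actE -natr_sum.
  set d := (deg e x)%:R; set S := (\sum_(j | e x j) deg e j)%:R.
  set N : R := n%:R - 1 in few *.
  have NE : N = n.-1%:R by rewrite /N -{1}(prednK (ltnW n_gt1)) -natr1 addrK.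
  have d_gt0 : 0 < d by rewrite ltr0n.
  have d_le : d <= N by rewrite NE ler_nat; have := deg_lt x irr_e; lia.
  have S_le1 : S <= d * N by rewrite NE -natrM ler_nat sum_deg_nbrs_le.
  have S_le2 : S + N <= (\sum_j deg e j)%:R.
    by rewrite NE -natrD ler_nat sum_deg_nbrs_add_le.
  have nE : n%:R = N + 1 :> R by rewrite /N subrK.
  rewrite nE in few *; move: (\sum_j _)%:R few S_le2 => D few S_le2.
  set b := 1 - alpha in few *.
  have b_gt0 : 0 < b by rewrite /b; lra.
  (* The bound S <= D - N makes the gap at most (d - N) (alpha d + 1 - b N); when the
     second factor is negative, S <= d N suffices. *)
  have [le0|lt0] := leP 0 (alpha * d + 1 - b * N).
    have bS : b * S <= b * (D - N) by rewrite ler_pM2l //; lra.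
    have : (d - N) * (alpha * d + 1 - b * N) <= 0 by rewrite mulr_le0_ge0 // subr_le0.
    by rewrite /b in few bS *; lra.
  have bS : b * S <= b * (d * N) by rewrite ler_pM2l.
  (* From [alpha >= 1/2], [b <= alpha], so [alpha * d + 1 - alpha * N] is negative as well. *)
  have bN : b * N <= alpha * N by rewrite ler_wpM2r /b; lra.
  have : d * (alpha * d + 1 - alpha * N) <= 0 by rewrite pmulr_rle0 //; lra.
  by rewrite /b in bS *; lra.
apply: (proj1 (Collatz_Wielandt sym_e _ _ deg_sup eig_r)) => [|x]; last by rewrite ltr0n.
by apply/andP; split; lra.
Qed.

End DegreeBound.

(** * A positive eigenvector of the extremal graph *)

Section ExtremalEigenvector.
Local Open Scope ring_scope.
Variables (R : rcfType) (alpha : R) (t N : nat).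
Hypotheses (alpha01 : 0 < alpha < 1) (t_gt0 : (0 < t)%N) (N_gt0 : (0 < N)%N).
Local Notation beta := (1 - alpha).
Local Notation ext := (extremal_graph (t + N).+1 t.+1).

(** Vectors constant on the cells of the equitable partition: the joined clique with [t = tau - 1]
    vertices, the clique with [N = n - tau] vertices, and the [K_1] at [ord_max]. *)
Definition three_valued (a b c : R) (i : 'I_(t + N).+1) : R :=
  if (i < t)%N then a else if i == ord_max then c else b.

Lemma sum_three_valued a b c :
  \sum_i three_valued a b c i = t%:R * a + N%:R * b + c.
Proof.
rewrite big_ord_recr /= {2}/three_valued /= eqxx ltnNge leq_addr /=.
congr (_ + _); rewrite big_split_ord /= /three_valued; congr (_ + _).
  under eq_bigr => i _ do rewrite /= ltn_ord.
  by rewrite sumr_const card_ord mulr_natl.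
rewrite (eq_bigr (fun=> b)) ?sumr_const ?card_ord ?mulr_natl // => i _ /=.
rewrite ltnNge leq_addr /= ifF //; apply/negbTE; rewrite -val_eqE /=.
by have := ltn_ord i; lia.
Qed.

Lemma sum_three_valued_lt a b c :
  \sum_(i : 'I_(t + N).+1 | (i < t)%N) three_valued a b c i = t%:R * a.
Proof.
rewrite -[RHS]addr0 -[in RHS](addr0 (t%:R * a)) -{2}(mulr0 N%:R) -sum_three_valued.
rewrite big_mkcond; apply: eq_bigr => i _; rewrite /three_valued.
by case: ifP => //; case: ifP.
Qed.

(** The three entries are the rows of the quotient matrix. For the two cliques they come from the
    sum over all vertices by removing the non-neighbours. *)
Lemma A_alpha_act_extremal a b c (i : 'I_(t + N).+1) :
  A_alpha_act alpha ext (three_valued a b c) i =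
  three_valued
    (alpha * ((t + N)%:R * a) + beta * ((t%:R - 1) * a + N%:R * b + c))
    (alpha * ((t + N)%:R - 1) * b + beta * (t%:R * a + (N%:R - 1) * b))
    (alpha * (t%:R * c) + beta * (t%:R * a)) i.
Proof.
pose z := three_valued a b c.
have sum_z : \sum_j z j = t%:R * a + N%:R * b + c by exact: sum_three_valued.
have sum_all x : \sum_j (alpha * z x + beta * z j) =
    alpha * ((t + N)%:R + 1) * z x + beta * (t%:R * a + N%:R * b + c).
  rewrite big_split /= sumr_const -mulr_sumr sum_z card_ord.
  by rewrite -[(_ + _).+1]addn1 -mulr_natr natrD; ring.
rewrite {2}/three_valued /A_alpha_act -/z; case: (ltnP i t) => it.
  have zi : z i = a by rewrite /z /three_valued it.
  have := sum_all i; rewrite (bigD1 i) //= zi => sum_i.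
  rewrite (eq_bigl (fun j => j != i)) => [|j]; first by lra.
  by rewrite /extremal_graph /= it /= andbT eq_sym.
have [i_max|i_max] := eqVneq i ord_max.
  have zi : z i = c by rewrite /z /three_valued ltnNge it i_max eqxx.
  rewrite (eq_bigl (fun j : 'I_(t + N).+1 => (j < t)%N)) => [|j]; last first.
    rewrite /extremal_graph i_max /= eqxx /= orbF ltnNge leq_addr /=.
    by rewrite -val_eqE /= andb_idl // => jt; apply/negP => /eqP; lia.
  rewrite big_split /= -[X in _ + X]mulr_sumr sum_three_valued_lt zi big_mkcond /=.
  (* Written as a three-valued vector, the constant [c] over the [t] neighbours is summed by
     [sum_three_valued]. *)
  rewrite (eq_bigr (fun j => alpha * three_valued c 0 0 j)); last first.
    by move=> j _; rewrite /three_valued if_same; case: ifP; rewrite ?mulr0.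
  by rewrite -mulr_sumr sum_three_valued; ring.
have zi : z i = b by rewrite /z /three_valued ltnNge it (negPf i_max).
have zmax : z ord_max = c by rewrite /z /three_valued ltnNge leq_addr eqxx.
have := sum_all i; rewrite (bigD1 i) //= (bigD1 ord_max) /=; last by rewrite eq_sym.
rewrite zi zmax => sum_i.
rewrite (eq_bigl (fun j => (j != i) && (j != ord_max))) => [|j].
  by lra.
rewrite /extremal_graph /= ltnNge it /= eq_sym; congr (_ && _).
rewrite -!val_eqE /= in i_max *; rewrite i_max /=.
by case: (ltnP j t) => //= jt; apply/esym/negP => /eqP; lia.
Qed.

(* Eliminating the entries b and c of the eigenvector (1, b, c) turns the
   eigenvalue equation into a cubic in mu, negative at n - 2 and nonnegative
   at n - 1, where n = t + N + 1. *)
Lemma extremal_positive_eigenvector :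
  exists mu, exists2 y : 'I_(t + N).+1 -> R, (t + N)%:R - 1 < mu & 
    (forall i, 0 < y i) /\ forall i, A_alpha_act alpha ext y i = mu * y i.
Proof.
case/andP: alpha01 => a0 a1.
have T_ge1 : 1 <= t%:R :> R by rewrite ler1n.
have N_ge1 : 1 <= N%:R :> R by rewrite ler1n.
set T : R := t%:R in T_ge1 *; set M : R := N%:R in N_ge1 *.
have b0 : 0 < beta by rewrite subr_gt0.
have bT : 0 < beta * T by rewrite mulr_gt0 //; lra.
have bM : 0 < beta * M by rewrite mulr_gt0 //; lra.
have aT : alpha * T <= T by rewrite ler_piMl //; lra.
(* [k1], [k2] and [alpha * T] are the diagonal entries of the quotient matrix, and [F] is its
   characteristic polynomial. *)
pose k1 := alpha * (T + M) + beta * (T - 1).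
pose k2 := T + M - 1 - beta * T.
pose F : {poly R} := ('X - k1%:P) * ('X - k2%:P) * ('X - (alpha * T)%:P) -
  (beta * M * (beta * T))%:P * ('X - (alpha * T)%:P) -
  (beta * (beta * T))%:P * ('X - k2%:P).
have FE x : F.[x] = (x - k1) * (x - k2) * (x - alpha * T) -
  beta * M * (beta * T) * (x - alpha * T) - beta * (beta * T) * (x - k2).
  by rewrite /F !hornerE.
have F_lt0 : F.[T + M - 1] < 0.
  rewrite FE (_ : _ - _ = - (alpha * (beta * T) * (T + M - 1 - alpha * T) +
    beta * (beta * T) * (beta * T))); last by rewrite /k1 /k2; ring.
  rewrite oppr_lt0 addr_gt0 ?mulr_gt0 //; lra.
have F_ge0 : 0 <= F.[T + M].
  rewrite FE (_ : _ - _ = beta * M * (T + M - alpha * T) + beta * M * (1 + beta * T)).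
    by rewrite addr_ge0 // mulr_ge0 //; lra.
  by rewrite /k1 /k2; ring.
have [|mu /andP[mu_ge mu_le] /rootP F_mu] :=
    @poly_ivt R F (T + M - 1) (T + M) _ (introT andP (conj (ltW F_lt0) F_ge0)).
  by rewrite gerBl.
have mu_gt : T + M - 1 < mu.
  by rewrite lt_neqAle mu_ge andbT; apply: contraTneq F_lt0 => ->; rewrite F_mu ltxx.
have p1_gt0 : 0 < mu - k2 by rewrite /k2; lra.
have p2_gt0 : 0 < mu - alpha * T by lra.
(* The second and third rows force [b] and [c]; the first row is then [F.[mu] = 0] divided by
   [(mu - k2) * (mu - alpha * T)]. *)
pose b := beta * T / (mu - k2); pose c := beta * T / (mu - alpha * T).
have bE : b * (mu - k2) = beta * T by rewrite divfK ?gt_eqF.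
have cE : c * (mu - alpha * T) = beta * T by rewrite divfK ?gt_eqF.
exists mu, (three_valued 1 b c); first by rewrite natrD.
split=> i; first by rewrite /three_valued; case: ifP => // _; case: ifP; rewrite divr_gt0.
rewrite A_alpha_act_extremal natrD -/T -/M.
rewrite /three_valued; case: ifP => _; last case: ifP => _.
- have /eqP : (mu - k2) * (mu - alpha * T) * (mu - k1 - beta * M * b - beta * c) = 0.
    by rewrite -F_mu FE -{1}bE -cE; ring.
  by rewrite mulf_eq0 mulf_eq0 (gt_eqF p1_gt0) (gt_eqF p2_gt0) => /eqP; rewrite /k1; lra.
- lra.
- move: bE; rewrite /k2; lra.
Qed.

End ExtremalEigenvector.

(** * Components after deleting [S], and the edges missing between them *)

Section Components.
Variables (n : nat) (e : rel 'I_n) (S : {set 'I_n}).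
Hypotheses (sym_e : symmetric e) (irr_e : irreflexive e).

(** This form is convertible to the set counted by [ncomp_del] and gives access to the theory of
    partitions. *)
Definition components_del : {set {set 'I_n}} :=
  equivalence_partition (connect (del_rel e S)) (~: S).

Lemma ncomp_delE : ncomp_del e S = #|components_del|.
Proof. by []. Qed.

Lemma components_del_partition : partition components_del (~: S).
Proof.
apply: equivalence_partitionP => x y z _ _ _; split=> [|xy]; first exact: connect0.
have symR : connect_sym (del_rel e S).
  by apply: sym_connect_sym => u v; rewrite /del_rel /= sym_e [X in _ && X]andbC.
by rewrite (same_connect symR xy).
Qed.

(** All neighbours of [x] lie in [S] or in [C], and [x] is not its own neighbour. *)
Lemma deg_lt_component (C : {set 'I_n}) x :
  C \in components_del -> x \in C -> deg e x < #|S| + #|C|.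
Proof.
move=> PC xC; have /and3P[/eqP covP trivP _] := components_del_partition.
have sC y : y \in ~: S -> connect (del_rel e S) x y -> y \in C.
  case/imsetP: PC xC => z zS ->; rewrite !inE => /andP[xS zx] yS xy.
  by rewrite yS (connect_trans zx xy).
have xS : x \notin S.
  by rewrite -in_setC -covP; apply/bigcupP; exists C.
apply: leq_trans (leq_card_setU S C); rewrite ltnNge.
have nbrs_sub : [set j | e x j] \subset (S :|: C) :\ x.
  apply/subsetP => y; rewrite !inE => exy; apply/andP; split.
    by apply: contraTneq exy => ->; rewrite irr_e.
  case: (boolP (y \in S)) => //= yS; apply: sC; first by rewrite inE.
  by apply: connect1; rewrite /del_rel /= exy xS yS.
rewrite -ltnNge; apply: leq_ltn_trans (subset_leq_card nbrs_sub) _.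
by rewrite [ltnRHS](cardsD1 x) !inE xC orbT.
Qed.

Lemma sum_card_components_del : \sum_(C in components_del) #|C| = n - #|S|.
Proof.
by rewrite -(card_partition components_del_partition) -[n in n - _]card_ord -(cardsC S) addKn.
Qed.

Lemma card_component_gt0 (C : {set 'I_n}) : C \in components_del -> 0 < #|C|.
Proof.
move=> PC; rewrite card_gt0; apply: contraTneq PC => ->.
by case/and3P: components_del_partition.
Qed.

(** Each vertex of a component [C] misses the [n - #|S| - #|C|] vertices of the other components. *)
Lemma sum_deg_components : \sum_x deg e x +
  \sum_(C in components_del) #|C| * (n - #|S| - #|C|) <= n * n.-1.
Proof.
have card_S : #|S| + (n - #|S|) = n.
  by rewrite subnKC // -[n in _ <= n]card_ord max_card.
rewrite (bigID (mem S)) /= -[X in _ <= X * _]card_S mulnDl -addnA leq_add //.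
  by rewrite -sum_nat_const; apply: leq_sum => x _; have := deg_lt x irr_e; lia.
rewrite (eq_bigl (mem (~: S))) => [|x]; last by rewrite !inE.
rewrite (set_partition_big _ components_del_partition) /= -big_split /=.
rewrite -[X in _ <= X * _]sum_card_components_del big_distrl /=; apply: leq_sum => C PC.
have C_le : #|C| <= n - #|S|.
  by rewrite -sum_card_components_del (bigD1 C) //= leq_addr.
have deg_C : \sum_(x in C) deg e x <= #|C| * (#|S| + #|C|).-1.
  rewrite -sum_nat_const; apply: leq_sum => x xC.
  by have := deg_lt_component PC xC; lia.
have := card_component_gt0 PC => C_gt0.
apply: leq_trans (leq_add deg_C (leqnn _)) _.
by rewrite -mulnDr leq_mul2l; apply/orP; right; move: C_gt0 C_le card_S;
set s := #|S|; set c := #|C|; lia.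
Qed.

(** Sum over [C] of [(#|C| - q) * (n - #|S| - #|C| - k * q) >= 0]; the second factor is nonnegative
    because the other [k] components have at least [q] vertices each. Equality holds when all
    components but one have size [q]. *)
Lemma sum_component_gaps_ge q k : 0 < k ->
  #|components_del| = k.+1 -> (forall C, C \in components_del -> q <= #|C|) ->
  k.+1 * (q * (n - #|S| - k * q)) + (k - 1) * q * (n - #|S|) <=
    \sum_(C in components_del) #|C| * (n - #|S| - #|C|).
Proof.
move=> k_gt0 cardP q_le; rewrite -{2}sum_card_components_del -cardP -sum_nat_const.
rewrite big_distrr -big_split /=; apply: leq_sum => C PC.
have : \sum_(D in components_del | D != C) q <= \sum_(D in components_del | D != C) #|D|.
  by apply: leq_sum => D /andP[PD _]; exact: q_le.
have -> : \sum_(D in components_del | D != C) q = k * q.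
  rewrite (eq_bigl (mem (components_del :\ C))) => [|D]; last by rewrite !inE andbC.
  rewrite sum_nat_const; congr (_ * _).
  by apply: succn_inj; rewrite -cardP (cardsD1 C components_del) PC.
have := sum_card_components_del; rewrite (bigD1 C) //=.
set m := n - #|S|; set r := \sum_(_ in _ | _) _ => m_eq r_ge.
have := q_le _ PC; rewrite -m_eq => qC.
rewrite -(subnKC qC) -(subnKC r_ge); set a := #|C| - q; set b := r - _.
rewrite addKn (addnCA (q + a)) addKn -(prednK k_gt0) subn1 /=.
nia.
Qed.

End Components.

(** Here [M] stands for twice the number of non-edges between the [k + 1] components left by
    deleting [s] vertices; [(4 * tau + 1) * (tau + 1)] is [4 * tau ^ 2 + 5 * tau + 1]. *)
Lemma nonedges_arith n tau k s M :
  (4 * tau + 1) * (tau + 1) <= n -> 2 <= k -> s < tau * k -> s + k < n ->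
  2 * k * (n - s) <= M + k * k + k -> 4 * n <= M + 8 * tau + 2.
Proof.
move=> n_ge k_ge s_lt sk_lt M_ge.
(* For small [n], [n - s >= k + 1] gives [M >= k * (k + 1)], and [k >= 4 * tau + 1] makes this
   suffice. *)
have [n_le|n_gt] := leqP n ((tau + 1) * k).
  have : 4 * tau + 1 <= k by nia.
  have : 2 * k * (k + 1) <= 2 * k * (n - s) by rewrite leq_mul2l; lia.
  nia.
(* With [s <= tau * k - 1], the right side of the goal exceeds the left by at least [(k - 2) * (2 *
   n + 1 - (2 * tau + 1) * (k + 2))]. *)
have : (2 * tau + 1) * (k + 2) <= 2 * n + 1 by nia.
have : 2 * k * (n + 1) <= 2 * k * (n - s) + 2 * k * (tau * k).
  by rewrite -mulnDr leq_mul2l; lia.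
nia.
Qed.

Lemma not_tough_cases n tau (e : rel 'I_n) (S : {set 'I_n}) :
  simple_graph e -> 4 * tau ^ 2 + 5 * tau + 1 <= n ->
  1 < ncomp_del e S -> #|S| < tau * (ncomp_del e S - 1) ->
  (exists v, deg e v < tau) \/ \sum_x deg e x + 4 * n <= n * n.-1 + 8 * tau + 2.
Proof.
move=> [sym_e irr_e] n_ge; rewrite ncomp_delE.
case cardP: #|_| => [|k] //; rewrite ltnS subn1 /= => k_gt0 S_lt.
have sum_deg := sum_deg_components S sym_e irr_e.
set M := \sum_(C in _) _ in sum_deg.
have gaps q := @sum_component_gaps_ge n e S sym_e q k k_gt0 cardP.
have S_le : k.+1 <= n - #|S|.
  rewrite -(sum_card_components_del S sym_e) -cardP -sum1_card; apply: leq_sum => C.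
  exact: card_component_gt0.
(* With two components [#|S| < tau]: a one-vertex component yields the vertex of low degree, and
   otherwise the gap bound applies with [q = 2]. With more components [q = 1] is enough. *)
have [k1|k_neq1] := eqVneq k 1.
  have [/existsP[C /andP[PC C1]]|no1] := boolP [exists C in components_del e S, #|C| < 2].
    have /card_gt0P[v vC] := card_component_gt0 sym_e PC.
    left; exists v; apply: leq_trans (deg_lt_component sym_e irr_e PC vC) _.
    by move: S_lt C1; rewrite k1; set s := #|S|; set c := #|C|; lia.
  right; have {}gaps : 2 * (2 * (n - #|S| - 2)) <= M.
    rewrite /M; apply: leq_trans (gaps 2 _); first by rewrite k1; set m := n - _; lia.
    move=> C PC; rewrite leqNgt; apply: contra no1 => C1.
    by apply/existsP; exists C; rewrite PC.
  move: S_lt S_le gaps sum_deg; rewrite k1 muln1.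
  set s := #|S|; set D := \sum_x _; set E := n * _; lia.
right; have {}gaps : 2 * k * (n - #|S|) <= M + k * k + k.
  apply: leq_trans (_ : k.+1 * (1 * (n - #|S| - k * 1)) + (k - 1) * 1 * (n - #|S|)
    + k * k + k <= _).
    rewrite !muln1 mul1n -(subnK (ltnW S_le)) addnK; move: (_ - k) => a.
    rewrite -(prednK k_gt0) subn1 /=; move: k.-1 => j; lia.
  by rewrite !leq_add2r; apply: gaps => C; apply: card_component_gt0.
have k_ge2 : 2 <= k by rewrite ltn_neqAle eq_sym k_neq1.
have sk_lt : #|S| + k < n by move: S_le; set s := #|S|; lia.
have tau_n : (4 * tau + 1) * (tau + 1) <= n by move: n_ge; clear; lia.
have := nonedges_arith tau_n k_ge2 S_lt sk_lt gaps.
by move: sum_deg; set D := \sum_x _; set E := n * _; lia.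
Qed.

(** * Embedding into the extremal graph, and monotonicity *)

Lemma low_degree_embedding n tau (e : rel 'I_n) v :
  simple_graph e -> deg e v < tau ->
  exists f, bijective f /\ forall x y, e x y -> extremal_graph n tau (f x) (f y).
Proof.
move=> [sym_e irr_e] deg_v.
(* Listing the neighbours of [v] first and [v] last sends [v] to the [K_1] and its at most [tau - 1]
   neighbours into the joined clique; the embedding is the position in [s]. *)
pose nbr := [set j | e v j]; pose s := enum nbr ++ enum (~: (v |: nbr)) ++ [:: v].
have vN : v \notin nbr by rewrite inE irr_e.
have size_s : size s = n.
  have cU : #|v |: nbr| = #|nbr|.+1 by rewrite cardsU1 vN.
  by rewrite !size_cat -!cardE /= addn1 addnS -addSn -cU cardsC card_ord.
have s_all x : x \in s.
  by rewrite !mem_cat !mem_enum !inE; case: (x == v); case: (e v x).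
have s_index x : index x s < n by rewrite -[ltnRHS]size_s index_mem.
pose f x := Ordinal (s_index x).
have f_inj : injective f.
  move=> x y /(congr1 val) /= xy.
  by rewrite -(nth_index v (s_all x)) xy nth_index.
have f_nbr y : e v y -> val (f y) < tau.-1.
  move=> vy; rewrite /= index_cat mem_enum inE vy.
  apply: (@leq_trans (deg e v)); last by lia.
  by rewrite /deg cardE index_mem mem_enum inE.
have f_max x : val (f x) = n.-1 -> x = v.
  have <- : nth v s n.-1 = v by have := nth_last v s; rewrite size_s !last_cat.
  by move=> <-; rewrite nth_index.
exists f; split=> [|x y exy]; first exact: injF_bij.
have x_neq_y : x != y by apply: contraTneq exy => ->; rewrite irr_e.
rewrite /extremal_graph (inj_eq f_inj) x_neq_y /=.
have [xv|xv] := eqVneq x v; first by rewrite (f_nbr y) ?orbT // -xv.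
have [yv|yv] := eqVneq y v; first by rewrite (f_nbr x) // -yv sym_e.
have neq_max z : z != v -> val (f z) != n.-1.
  by apply: contra_neq => /f_max.
by rewrite !neq_max ?orbT.
Qed.

Section Monotonicity.
Local Open Scope ring_scope.

(** Each extra edge of [e2] adds a strictly positive term, so equality in a row means equal
    neighbourhoods. *)
Lemma A_alpha_act_mono (R : realFieldType) (alpha : R) n (e1 e2 : rel 'I_n) z (f : 'I_n -> 'I_n) :
  0 < alpha < 1 -> (forall i, 0 < z i) -> bijective f ->
  (forall x y, e1 x y -> e2 (f x) (f y)) ->
  forall x, A_alpha_act alpha e1 (z \o f) x <= A_alpha_act alpha e2 z (f x) ?= iff
    [forall y, e1 x y == e2 (f x) (f y)].
Proof.
move=> /andP[a0 a1] z_gt0 f_bij sub x.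
have term_gt0 y : 0 < alpha * z (f x) + (1 - alpha) * z (f y).
  by rewrite addr_gt0 // mulr_gt0 // subr_gt0.
rewrite /A_alpha_act [X in _ <= X ?= iff _](reindex f) /=; last exact: onW_bij.
rewrite [X in X <= _ ?= iff _]big_mkcond [X in _ <= X ?= iff _]big_mkcond /=.
under eq_forallb => y do rewrite -[e1 x y == _]implyTb.
apply: leif_sum => y _; case exy : (e1 x y).
  by rewrite (sub x y exy); split; rewrite ?lexx ?eqxx.
case: (e2 _ _); split; rewrite ?lexx ?eqxx //; first exact: ltW.
by rewrite lt_eqF.
Qed.

End Monotonicity.

Theorem theorem1p2 (R : rcfType) (n tau : nat) (e : rel 'I_n) (alpha : R)
    (rG rK : R) :
  simple_graph e -> connected_graph e ->
  (2 <= tau)%N ->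
  (1 / 2 <= alpha)%R -> (alpha < 3 / 4)%R ->
  (4 * tau ^ 2 + 5 * tau + 1 <= n)%N ->
  ((8 * tau%:R * (1 - alpha) - 2 * alpha + 1) / (3 - 4 * alpha) <= n%:R)%R ->
  is_largest_eigenvalue (A_alpha alpha e) rG ->
  is_largest_eigenvalue (A_alpha alpha (extremal_graph n tau)) rK ->
  (rK <= rG)%R ->
  tough e tau \/ graph_iso e (extremal_graph n tau).
Proof.
move=> simp_e conn_e tau_ge2 a12 a34 n_ge alpha_n [eig_G _] [_ rK_max] rK_le.
have [sym_e irr_e] := simp_e.
have [t t_gt0 tauE] : exists2 t, 0 < t & tau = t.+1 by exists tau.-1; lia.
have [N N_gt0 nE] : exists2 N, 0 < N & n = (t + N).+1 by exists (n - tau); nia.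
have a01 : (0 < alpha < 1)%R by apply/andP; split; lra.
have ext_sym : symmetric (extremal_graph n tau).
  move=> x y; rewrite /extremal_graph eq_sym orbCA; congr (_ && [|| _, _ | _]).
  exact: andbC.
have [mu [y mu_gt [y_gt0 y_eig]]] : exists mu, exists2 y : 'I_n -> R, (n%:R - 2 < mu)%R &
    (forall i, (0 < y i)%R) /\
    forall i, A_alpha_act alpha (extremal_graph n tau) y i = (mu * y i)%R.
  subst n tau; have [mu [y mu_gt y_eig]] := extremal_positive_eigenvector a01 t_gt0 N_gt0.
  by exists mu, y => //; move: mu_gt; rewrite -natr1; lra.
(* [mu] is an eigenvalue of the extremal graph, so [mu <= rK <= rG]. *)
have mu_le : (mu <= rG)%R.
  apply: le_trans rK_le; apply: rK_max; apply/eigenvalue_A_alpha => //.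
  exists y => //; have i : 'I_n by rewrite nE; exact: ord0.
  by exists i; rewrite gt_eqF.
have [|not_tough] := boolP [forall S : {set 'I_n}, (1 < ncomp_del e S) ==>
    (tau * (ncomp_del e S - 1) <= #|S|)].
  by move=> /forallP all_S; left=> S _; apply/implyP.
case/forallPn: not_tough => S; rewrite negb_imply -ltnNge => /andP[comp_S S_lt].
right; case: (not_tough_cases simp_e n_ge comp_S S_lt) => [[v deg_v]|few].
  have [f [f_bij f_sub]] := low_degree_embedding simp_e deg_v.
  have mono := A_alpha_act_mono a01 y_gt0 f_bij f_sub.
  have [x|x|_ tight] := Collatz_Wielandt (z := y \o f) (mu := mu) sym_e a01 _ _ eig_G.
  - exact: y_gt0.
  - by rewrite /= -y_eig (mono x).
  exists f; split=> // x z; apply/eqP.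
  have := tight conn_e mu_le x; rewrite /= -y_eig => /eqP.
  by rewrite (mono x) => /forallP.
have n_gt1 : 1 < n by nia.
have deg_e x : 0 < deg e x by apply: deg_gt0.
(* This contradicts [n - 2 < mu <= rG]. *)
suff: (rG <= n%:R - 2)%R by lra.
apply: (eigenvalue_le_sum_deg simp_e deg_e n_gt1 _ _ eig_G); first by apply/andP; split; lra.
have n_real : (n%:R - 1 = n.-1%:R :> R)%R.
  by rewrite -[X in (X%:R - 1)%R](prednK (ltnW n_gt1)) -natr1 addrK.
have few_real : ((\sum_x deg e x)%:R + 4 * n%:R <= n%:R * (n%:R - 1) + 8 * tau%:R + 2 :> R)%R.
  by rewrite n_real -!natrM -!natrD ler_nat.
(* With [3 - 4 * alpha > 0] cleared, the second bound on [n] says exactly that [n - 1 <= (1 - alpha)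
   * (4 * n - 8 * tau - 2)]. *)
rewrite ler_pdivrMr in alpha_n; last by lra.
have : ((1 - alpha) * (4 * n%:R - 8 * tau%:R - 2) <=
    (1 - alpha) * (n%:R * (n%:R - 1) - (\sum_x deg e x)%:R))%R.
  by rewrite ler_pM2l; lra.
lra.
Qed.
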